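(* Let $\mathcal{M} \subset \mathbb{R}^d$ be a nonempty compact convex set and let $f:\mathbb{R}^d \to \mathbb{R}$ be a continuously differentiable function, not necessarily convex, whose curvature constant $C_f$ over $\mathcal{M}$ (defined in the context) is finite. Let $(x^{(t)})_{t\ge 0}$ be iterates of the Frank-Wolfe algorithm (described in the context) for the problem $\min_{x\in\mathcal{M}} f(x)$, started at an arbitrary $x^{(0)}\in\mathcal{M}$, with arbitrary tie-breaking in the choice of minimizers, and run either (I) with line-search step sizes, in which case set $C := C_f$; or (II) with the step sizes $\gamma_t = \min\{g_t/C, 1\}$, for any fixed constant $C \ge C_f$ with $C>0$. Let $g_t$ denote the Frank-Wolfe gap at $x^{(t)}$, let $\tilde g_t := \min_{0\le k\le t} g_k$, and let $h_0 := f(x^{(0)}) - \min_{x\in\mathcal{M}} f(x)$. Then $$\tilde g_t \;\le\; \frac{\max\{2h_0,\, C\}}{\sqrt{t+1}} \qquad \text{for all integers } t\ge 0.$$ Consequently, it takes at most $O(1/\epsilon^2)$ iterations to find an approximate stationary point with gap smaller than $\epsilon$: there is a constant $K$ depending only on $h_0$ and $C$ such that for every $\epsilon>0$ there is an integer $k$ with $0\le k \le K/\epsilon^2$ and $g_k < \epsilon$.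
   Context: Curvature constant. For a continuously differentiable $f:\mathbb{R}^d\to\mathbb{R}$ and a compact convex set $\mathcal{M}$, $$C_f := \sup_{\substack{x,s\in\mathcal{M},\ \gamma\in(0,1],\\ y = x+\gamma(s-x)}} \frac{2}{\gamma^2}\bigl( f(y) - f(x) - \langle \nabla f(x), y-x\rangle \bigr).$$ Frank-Wolfe algorithm (with adaptive step sizes). Start from $x^{(0)}\in\mathcal{M}$. For $t=0,1,2,\dots$: 1. choose $s^{(t)} \in \arg\min_{s\in\mathcal{M}} \langle s, \nabla f(x^{(t)})\rangle$ (ties broken arbitrarily); 2. set $d_t := s^{(t)} - x^{(t)}$; 3. define the Frank-Wolfe gap $g_t := \langle d_t, -\nabla f(x^{(t)})\rangle = \max_{s\in\mathcal{M}} \langle s - x^{(t)}, -\nabla f(x^{(t)})\rangle$; 4. choose the step size $\gamma_t$: under Option I (line-search), any $\gamma_t \in \arg\min_{\gamma\in[0,1]} f(x^{(t)}+\gamma d_t)$; under Option II, $\gamma_t := \min\{g_t/C, 1\}$ for a fixed constant $C\ge C_f$; 5. set $x^{(t+1)} := x^{(t)} + \gamma_t d_t$. The same option is used at every iteration. The algorithm is regarded as producing an infinite sequence of iterates (a practical implementation may stop once $g_t\le\epsilon$ for a prescribed tolerance $\epsilon$, which only truncates this sequence). A point $x^{(t)}$ is stationary for $\min_{x\in\mathcal{M}} f(x)$ if and only if $g_t=0$, and one always has $g_t\ge 0$. *)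

(* Defs.v *)
From mathcomp Require Export all_boot all_order all_algebra.
From mathcomp Require Export all_classical all_reals all_analysis.

Set Implicit Arguments.
Unset Strict Implicit.
Unset Printing Implicit Defensive.

Export Order.TTheory GRing.Theory Num.Theory numFieldNormedType.Exports.

Local Open Scope classical_set_scope.
Local Open Scope ring_scope.

Definition dot (R : realType) (d : nat) (u v : 'rV[R]_d) : R :=
  \sum_(i < d) u 0 i * v 0 i.

(* The entries are the partial derivatives of f along the canonical basis. *)
Definition gradient (R : realType) (d : nat) (f : 'rV[R]_d -> R)
    (x : 'rV[R]_d) : 'rV[R]_d :=
  \row_(i < d) 'D_(delta_mx 0 i) f x.

Definition continuously_differentiable (R : realType) (d : nat)
    (f : 'rV[R]_d -> R) : Prop :=
  (forall x : 'rV[R]_d, differentiable f x) /\ continuous (gradient f).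

(* The supremum is taken in the extended reals, so that it is +oo, and not a
   default value, when the set is unbounded. *)
Definition curvature (R : realType) (d : nat) (M : set 'rV[R]_d)
    (f : 'rV[R]_d -> R) : \bar R :=
  ereal_sup [set r : \bar R | exists (x s y : 'rV[R]_d) (gamma : R),
    [/\ M x /\ M s, 0 < gamma <= 1, y = x + gamma *: (s - x) &
        r = (2 / gamma ^+ 2 * (f y - f x - dot (gradient f x) (y - x)))%:E]].

Definition argmin (R : realType) (T : Type) (A : set T) (F : T -> R) : set T :=
  [set a | A a /\ forall b, A b -> F a <= F b].

(* For A nonempty and compact and F continuous, this infimum is a minimum: see
   [min_over_argmin] and [min_over_attained]. *)
Definition min_over (R : realType) (T : Type) (A : set T) (F : T -> R) : R :=
  inf (F @` A).

Lemma min_over_argmin (R : realType) (T : Type) (A : set T) (F : T -> R)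
    (a : T) :
  argmin A F a -> min_over A F = F a.
Proof.
move=> [Aa Fa]; apply/eqP; rewrite eq_le; apply/andP; split.
  by apply: ge_inf; [exists (F a) => _ [b Ab <-]; exact: Fa | exists a].
by apply: lb_le_inf; [exists (F a); exists a | move=> _ [b Ab <-]; exact: Fa].
Qed.

Lemma min_over_attained (R : realType) (d : nat) (M : set 'rV[R]_d)
    (f : 'rV[R]_d -> R) :
  M !=set0 -> compact M -> continuous f -> argmin M f !=set0.
Proof.
move=> M0 cM cf.
have [|c cM' fc] := EVT_min_rV (f := f) M0 cM; first exact: continuous_subspaceT.
by exists c; split => [|b Mb]; [exact: set_mem | apply: fc; exact: mem_set].
Qed.

(* For s a minimizer of <s, gradient f x> over M, this is also the maximum of
   <v - x, - gradient f x> over v in M. *)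
Definition fw_gap (R : realType) (d : nat) (f : 'rV[R]_d -> R)
    (x s : 'rV[R]_d) : R :=
  dot (s - x) (- gradient f x).

(* Iterates x, linear minimizers s and step sizes gamma of a Frank-Wolfe run,
   the rule by which gamma is chosen being left open. *)
Definition frank_wolfe (R : realType) (d : nat) (M : set 'rV[R]_d)
    (f : 'rV[R]_d -> R) (x s : nat -> 'rV[R]_d) (gamma : nat -> R) : Prop :=
  [/\ M (x 0%N),
      forall t : nat, argmin M (fun v => dot v (gradient f (x t))) (s t) &
      forall t : nat, x t.+1 = x t + gamma t *: (s t - x t)].

Definition line_search (R : realType) (d : nat) (f : 'rV[R]_d -> R)
    (x s : nat -> 'rV[R]_d) (gamma : nat -> R) : Prop :=
  forall t : nat,
    argmin `[0, 1] (fun c : R => f (x t + c *: (s t - x t))) (gamma t).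

Definition gap_step (R : realType) (d : nat) (f : 'rV[R]_d -> R) (C : R)
    (x s : nat -> 'rV[R]_d) (gamma : nat -> R) : Prop :=
  forall t : nat, gamma t = Num.min (fw_gap f (x t) (s t) / C) 1.

(* The initial value g 0 is one of the terms, so it does not affect the
   minimum. *)
Definition running_min (R : realType) (g : nat -> R) (t : nat) : R :=
  \big[Num.min/g 0%N]_(k < t.+1) g k.

(* Main.v *)
(* Both step-size rules decrease f by at least c g_t - c^2 C / 2 for *every*
   c in [0, 1]: the line search because it minimizes f along the segment, the
   gap-based rule because its step maximizes this quadratic over [0, 1]. Since
   the total decrease is at most h_0, summing over the n = t + 1 first
   iterations gives n (c g - c^2 C / 2) <= h_0 for the running minimum g, and
   c = 1 / sqrt n yields sqrt n * g <= h_0 + C / 2 <= max(2 h_0, C). *)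
Require Import Defs.
From mathcomp Require Import ring lra.

Set Implicit Arguments.
Unset Strict Implicit.
Unset Printing Implicit Defensive.

Local Open Scope classical_set_scope.
Local Open Scope ring_scope.

Section Dot.
Context {R : realType} {d : nat}.
Implicit Types (u v w : 'rV[R]_d) (c : R).

Lemma dotZl c u v : dot (c *: u) v = c * dot u v.
Proof. by rewrite /dot mulr_sumr; apply: eq_bigr => i _; rewrite mxE mulrA. Qed.

Lemma dotBl u v w : dot (u - v) w = dot u w - dot v w.
Proof. by rewrite /dot -sumrB; apply: eq_bigr => i _; rewrite !mxE mulrBl. Qed.

Lemma dotNr u v : dot u (- v) = - dot u v.
Proof. by rewrite /dot -sumrN; apply: eq_bigr => i _; rewrite mxE mulrN. Qed.

Lemma dotC u v : dot u v = dot v u.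
Proof. by apply: eq_bigr => i _; rewrite mulrC. Qed.

End Dot.

Lemma convex_set_segment (R : realType) (d : nat) (M : set 'rV[R]_d)
    (x s : 'rV[R]_d) (c : R) :
  convex_set M -> M x -> M s -> 0 <= c <= 1 -> M (x + c *: (s - x)).
Proof.
move=> cM Mx Ms /andP[c0 c1].
have /set_mem := cM s x (Itv01 c0 c1) (mem_set Ms) (mem_set Mx).
rewrite /conv/= /unstable.onem scalerBl scale1r.
by rewrite scalerBr addrCA.
Qed.

Lemma curvature_descent (R : realType) (d : nat) (M : set 'rV[R]_d)
    (f : 'rV[R]_d -> R) (C c : R) (x s : 'rV[R]_d) :
  (curvature M f <= C%:E)%E -> M x -> M s -> 0 <= c <= 1 ->
  f (x + c *: (s - x)) <= f x - (c * fw_gap f x s - c ^+ 2 * C / 2).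
Proof.
move=> CfC Mx Ms /andP[c0 c1].
(* The curvature set only admits step sizes in (0, 1], so [c = 0] is treated apart. *)
have [->|cN0] := eqVneq c 0; first by rewrite scale0r addr0; lra.
have {c0 cN0}c0 : 0 < c by rewrite lt_neqAle eq_sym cN0.
set y := x + _.
have : 2 / c ^+ 2 * (f y - f x - dot (gradient f x) (y - x)) <= C.
  rewrite -lee_fin; apply: le_trans CfC; apply: ereal_sup_ubound.
  by exists x, s, y, c; split => //; rewrite c0.
rewrite mulrAC ler_pdivrMr ?exprn_gt0// /y (addrC x) addrK dotC dotZl.
rewrite /fw_gap dotNr; lra.
Qed.

(** The quadratic is concave with vertex [g / C]. If the vertex is at most 1, the difference of the
    two sides is [(c - b) ^+ 2 * C / 2]; otherwise [g > C] and it is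
    [(1 - c) * (g - C) + (1 - c) ^+ 2 * C / 2]. *)
Lemma gap_step_maximizes (R : realType) (g C c : R) :
  0 < C -> c <= 1 -> let b := Num.min (g / C) 1 in
  c * g - c ^+ 2 * C / 2 <= b * g - b ^+ 2 * C / 2.
Proof.
move=> C0 c1 /=; have [gC|gC] := leP (g / C) 1.
  have gE : g = g / C * C by rewrite divfK// gt_eqF.
  set b := g / C in gE *; rewrite gE.
  have : 0 <= (c - b) ^+ 2 * C by rewrite mulr_ge0 ?sqr_ge0// ltW.
  lra.
move: gC; rewrite ltr_pdivlMr// mul1r => gC.
have : 0 <= (1 - c) * (g - C) by rewrite mulr_ge0 ?subr_ge0// ltW.
have : 0 <= (1 - c) ^+ 2 * C by rewrite mulr_ge0 ?sqr_ge0// ltW.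
lra.
Qed.

Lemma running_min_le (R : realType) (g : nat -> R) (t k : nat) :
  (k <= t)%N -> running_min g t <= g k.
Proof.
move=> kt; rewrite /running_min.
exact: (bigmin_le _ (Ordinal (kt : (k < t.+1)%N)) (fun i => g i)).
Qed.

Lemma running_min_attained (R : realType) (g : nat -> R) (t : nat) :
  exists2 k, (k <= t)%N & running_min g t = g k.
Proof.
rewrite /running_min; elim/big_ind: _ => [|a b [i it ->] [j jt ->]|i _].
- by exists 0%N.
- by case: leP => _; [exists i | exists j].
- by exists (val i); first exact: ltn_ord i.
Qed.

Section FrankWolfe.
Context {R : realType} {d : nat}.
Variables (M : set 'rV[R]_d) (f : 'rV[R]_d -> R).
Variables (x s : nat -> 'rV[R]_d) (gamma : nat -> R) (C : R).
Hypothesis convM : convex_set M.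
Hypothesis CfC : (curvature M f <= C%:E)%E.
Hypothesis fw : frank_wolfe M f x s gamma.
Hypothesis step : line_search f x s gamma \/ gap_step f C x s gamma /\ 0 < C.

Local Notation g := (fun t => fw_gap f (x t) (s t)).

(** Compares the linear minimizer [s t] with the feasible point [x t] itself. Feasibility is a
    premise because the induction in [fw_iterate_mem] derives it from this bound, through
    [fw_step_itv]. *)
Lemma fw_gap_ge0 t : M (x t) -> 0 <= g t.
Proof.
case: fw => _ /(_ t) [_ smin] _ Mx; have := smin _ Mx.
by rewrite /= /fw_gap dotNr dotBl; lra.
Qed.

Lemma fw_step_itv t : M (x t) -> 0 <= gamma t <= 1.
Proof.
move=> Mx; case: step => [/(_ t) [+ _]|[/(_ t) -> C0]].
  by rewrite /= in_itv.
by rewrite le_min ge_min lexx orbT ler01 !andbT divr_ge0 ?fw_gap_ge0// ltW.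
Qed.

Lemma fw_iterate_mem t : M (x t).
Proof.
case: (fw) => M0 smin xS; elim: t => // t IH; rewrite xS.
by apply: convex_set_segment => //; [case: (smin t) | exact: fw_step_itv].
Qed.

Lemma fw_descent t (c : R) : 0 <= c <= 1 ->
  f (x t.+1) <= f (x t) - (c * g t - c ^+ 2 * C / 2).
Proof.
move=> c01; have Mx := fw_iterate_mem t.
case: fw => _ /(_ t) [Ms _] xS; rewrite xS.
case: step => [/(_ t) [_ /(_ c)]|[/(_ t) gammaE C0]].
  rewrite /= in_itv/= => /(_ c01) fmin; apply: (le_trans fmin).
  exact: (curvature_descent CfC Mx Ms c01).
apply: (le_trans (curvature_descent CfC Mx Ms (fw_step_itv Mx))).
rewrite lerD2l lerN2 gammaE; apply: gap_step_maximizes => //.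
by case/andP: c01.
Qed.

Lemma fw_total_descent n (c v : R) :
  0 <= c <= 1 -> (forall k, (k < n)%N -> v <= g k) ->
  f (x n) <= f (x 0%N) - n%:R * (c * v - c ^+ 2 * C / 2).
Proof.
move=> c01; elim: n => [|n IH] vg; first by rewrite mul0r subr0.
have {}IH := IH (fun k kn => vg k (ltnW kn)).
have : c * v <= c * g n.
  by case/andP: c01 => c0 _; apply: ler_wpM2l => //; exact: vg.
have := fw_descent n c01.
rewrite -natr1; move: IH; set D := c ^+ 2 * C / 2; lra.
Qed.

Lemma fw_running_min_le t (m : R) : (forall y, M y -> m <= f y) ->
  running_min g t <= Num.max (2 * (f (x 0%N) - m)) C / Num.sqrt (t.+1)%:R.
Proof.
move=> mf; set r := Num.sqrt _.
have r0 : 0 < r by rewrite sqrtr_gt0.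
have r2 : r ^+ 2 = t.+1%:R by rewrite sqr_sqrtr.
have r1 : 1 <= r by rewrite -sqrtr1 ler_wsqrtr// ler1n.
have c01 : 0 <= r^-1 <= 1 by rewrite invr_ge0 ltW//= invf_le1.
have := fw_total_descent (n := t.+1) c01 (fun k => @running_min_le _ g t k).
have := mf _ (fw_iterate_mem t.+1).
rewrite -r2 ler_pdivlMr//; set v := running_min _ _.
(* With [c = r^-1] the total descent becomes [v * r <= h0 + C / 2], where [h0] is [f (x 0) - m]. The
   right side is the average of [2 * h0] and [C], hence at most the larger one. *)
have -> : r ^+ 2 * (r^-1 * v - r^-1 ^+ 2 * C / 2) = v * r - C / 2.
  by field; rewrite gt_eqF.
by rewrite le_max; case: (leP C (2 * (f (x 0%N) - m))) => ? ? ?;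
  apply/orP; [left|right]; lra.
Qed.

End FrankWolfe.

Lemma running_min_rate_lt (R : realType) (g : nat -> R) (B eps : R) :
  0 <= B -> 0 < eps ->
  (forall t, running_min g t <= B / Num.sqrt (t.+1)%:R) ->
  exists k : nat, k%:R <= B ^+ 2 / eps ^+ 2 /\ g k < eps.
Proof.
move=> B0 e0 gB; set q := B ^+ 2 / eps ^+ 2.
have q0 : 0 <= q by rewrite divr_ge0 ?sqr_ge0.
(* The floor satisfies [t <= q < t + 1]: the left bound controls the index [k <= t], and the strict
   right bound gives [B / eps < sqrt (t + 1)], hence a gap strictly below [eps]. *)
have /andP[tq qt] := truncn_itv q0; set t := Num.truncn q in tq qt.
have [k kt gk] := running_min_attained g t.
exists k; split; first by apply: le_trans tq; rewrite ler_nat.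
rewrite -gk; apply: le_lt_trans (gB t) _.
rewrite ltr_pdivrMr ?sqrtr_gt0// mulrC -ltr_pdivrMr//.
rewrite -(ger0_norm (divr_ge0 B0 (ltW e0))) -sqrtr_sqr ltr_sqrt ?ltr0Sn//.
by rewrite expr_div_n.
Qed.

Theorem theorem1 (R : realType) :
  exists K : R -> R -> R,
  forall (d : nat) (M : set 'rV[R]_d) (f : 'rV[R]_d -> R)
    (x s : nat -> 'rV[R]_d) (gamma : nat -> R) (C : R),
    M !=set0 -> compact M -> convex_set M ->
    continuously_differentiable f ->
    curvature M f \is a fin_num ->
    frank_wolfe M f x s gamma ->
    (line_search f x s gamma /\ C = fine (curvature M f)) \/
    (gap_step f C x s gamma /\ (curvature M f <= C%:E)%E /\ 0 < C) ->
    let g := fun t : nat => fw_gap f (x t) (s t) in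
    let h0 := f (x 0%N) - min_over M f in
    (forall t : nat,
       running_min g t <= Num.max (2 * h0) C / Num.sqrt (t.+1)%:R) /\
    (forall eps : R, 0 < eps ->
       exists k : nat, k%:R <= K h0 C / eps ^+ 2 /\ g k < eps).
Proof.
(* This is the [B ^+ 2] of [running_min_rate_lt], with [B] the numerator of the rate. *)
exists (fun h0 C => Num.max (2 * h0) C ^+ 2) => d M f x s gamma C.
move=> M0 cM convM [df _] Cfin fw rule g h0.
have CfC : (curvature M f <= C%:E)%E.
  (* Finiteness ensures that [fine] returns the true supremum and not its default value 0. *)
  by case: rule => [[_ ->]|[_ []//]]; rewrite fineK.
have step : line_search f x s gamma \/ gap_step f C x s gamma /\ 0 < C.
  by case: rule => [[? _]|[? [_ ?]]]; [left|right].
have [a aM] : argmin M f !=set0.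
  by apply: min_over_attained => // y; exact: differentiable_continuous.
have mf y : M y -> min_over M f <= f y.
  by move=> My; rewrite (min_over_argmin aM); case: aM => _; exact.
have rate t : running_min g t <= Num.max (2 * h0) C / Num.sqrt (t.+1)%:R.
  exact: (fw_running_min_le convM CfC fw step t mf).
split=> // eps e0; apply: running_min_rate_lt => //.
by rewrite le_max mulr_ge0 ?subr_ge0 ?mf//; case: fw.
Qed.
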